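(* Consider SVRCD (defined in the context) with stepsize $\alpha=\min_i\frac1{4m_i/p_i+\sigma/\rho}$. Then its iteration complexity is $\left(\frac1\rho+\max_i\frac{4m_i}{p_i\sigma}\right)\log\frac1\epsilon$; that is, there exists $\beta>0$ such that, with $$\Psi^k=\|x^k-x^*\|^2+\alpha\beta^2\sum_{i=1}^d\frac1{m_i}\left(h_i^k-\nabla_if(x^* )\right)^2,$$ for every $\epsilon\in(0,1)$ and every integer $k\ge\left(\frac1\rho+\max_i\frac{4m_i}{p_i\sigma}\right)\log\frac1\epsilon$ we have $\mathbb E[\Psi^k]\le\epsilon\,\Psi^0$.
   Context: Problem. $f:\mathbb R^d\to\mathbb R$ is differentiable and convex, $\psi:\mathbb R^d\to\mathbb R\cup\{+\infty\}$ is proper, closed and convex. $\min_x f(x)+\psi(x)$ has a unique minimizer $x^*$, and $f$ is $\sigma$-quasi strongly convex with $\sigma>0$: $f(x^* )\ge f(y)+\langle\nabla f(y),x^*-y\rangle+\frac\sigma2\|y-x^*\|^2$ for all $y$. $f$ is $\mathbf M$-smooth with $\mathbf M=\mathrm{diag}(m_1,\dots,m_d)$, $m_1,\dots,m_d>0$: $f(x)\le f(y)+\langle\nabla f(y),x-y\rangle+\frac12\sum_i m_i(x_i-y_i)^2$ for all $x,y$. $\mathrm{prox}_{\alpha\psi}(x)=\arg\min_u\{\alpha\psi(u)+\frac12\|u-x\|^2\}$; $e_i$ is the $i$-th standard basis vector of $\mathbb R^d$. Sampling. $L$ is a random subset of $[d]$ with arbitrary distribution such that $p_i=\mathbb P(i\in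 L)>0$ for all $i$; $\rho\in(0,1]$. Algorithm (SVRCD). Given $x^0\in\mathbb R^d$, set $h^0=0\in\mathbb R^d$. For $k=0,1,2,\dots$: draw $L^k$, a copy of $L$ independent of the past; $g^k=h^k+\sum_{i\in L^k}\frac1{p_i}(\nabla_if(x^k)-h_i^k)e_i$; $x^{k+1}=\mathrm{prox}_{\alpha\psi}(x^k-\alpha g^k)$; independently of $L^k$ and of the past, set $h^{k+1}=\nabla f(x^k)$ with probability $\rho$ and $h^{k+1}=h^k$ with probability $1-\rho$. *)

(* Defs.v *)
From HB Require Import structures.
From mathcomp Require Import all_boot all_order all_algebra.
From mathcomp Require Import all_classical all_reals all_analysis.

Set Implicit Arguments.
Unset Strict Implicit.
Unset Printing Implicit Defensive.

Import Order.TTheory GRing.Theory Num.Theory.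
Import numFieldNormedType.Exports.

Local Open Scope classical_set_scope.
Local Open Scope ring_scope.

(* Vectors of R^n are row vectors. The library norm `|x| on 'rV[R]_n is the sup
   norm (it is only used here through the topology it induces), so the Euclidean
   inner product and squared norm are defined explicitly. *)
Section euclidean.
Context {R : realType} {n : nat}.
Implicit Types x y : 'rV[R]_n.

Definition dotv x y : R := \sum_(i < n) x 0 i * y 0 i.

Definition sqnorm x : R := dotv x x.

End euclidean.

Definition grad {R : realType} {n : nat} (f : 'rV[R]_n -> R) (x : 'rV[R]_n) :
  'rV[R]_n := \row_(i < n) 'D_(delta_mx 0 i) f x.

(* Seeding the fold with one of its own terms makes it the plain minimum
   (maximum) of a nonempty family. *)
Definition min_fam {R : realType} {n : nat} (a : 'I_n.+1 -> R) : R :=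
  \big[Num.min/a ord0]_(i < n.+1) a i.

Definition max_fam {R : realType} {n : nat} (a : 'I_n.+1 -> R) : R :=
  \big[Num.max/a ord0]_(i < n.+1) a i.

Section convex_optimization.
Context {R : realType} {n : nat}.
Local Notation V := 'rV[R]_n.
Implicit Types (f : V -> R) (psi : V -> \bar R).

Definition convex_fun f : Prop :=
  convex_function (setT : set (convex_lmodType V)) f.

Definition proper_efun psi : Prop :=
  (forall x, psi x != -oo%E) /\ (exists x, (psi x < +oo)%E).

Definition epigraph psi : set (V * R) := [set xt | (psi xt.1 <= xt.2%:E)%E].

Definition closed_efun psi : Prop := closed (epigraph psi).

(* Meaningful for functions that never take the value -oo; note that
   0 * +oo = 0 in \bar R. *)
Definition convex_efun psi : Prop :=
  forall (x y : V) (t : R), 0 <= t <= 1 ->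
    (psi (t *: x + (1 - t) *: y)%R <= t%:E * psi x + (1 - t)%:E * psi y)%E.

Definition argmin (F : V -> \bar R) : set V :=
  [set u | forall v, (F u <= F v)%E].

(* [get] picks an element of the set, which for a positive stepsize and a
   proper closed convex psi is a singleton. *)
Definition prox (alpha : R) psi (x : V) : V :=
  get (argmin (fun u => alpha%:E * psi u + (2^-1 * sqnorm (u - x))%R%:E)%E).

Definition quasi_strongly_convex (sigma : R) f (xstar : V) : Prop :=
  forall y, f xstar >= f y + dotv (grad f y) (xstar - y)
                       + sigma / 2 * sqnorm (y - xstar).

Definition diag_smooth (m : 'I_n -> R) f : Prop :=
  forall x y, f x <= f y + dotv (grad f y) (x - y)
                     + 2^-1 * \sum_(i < n) m i * (x 0 i - y 0 i) ^+ 2.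

End convex_optimization.

Section svrcd.
Context {R : realType} {n : nat}.
Local Notation V := 'rV[R]_n.
Variables (f : V -> R) (psi : V -> \bar R) (p : 'I_n -> R) (alpha : R).

Definition svrcd_estimator (L : {set 'I_n}) (x h : V) : V :=
  h + \sum_(i in L) ((p i)^-1 * (grad f x 0 i - h 0 i)) *: delta_mx 0 i.

Definition svrcd_step (L : {set 'I_n}) (b : bool) (s : V * V) : V * V :=
  let: (x, h) := s in
  (prox alpha psi (x - alpha *: svrcd_estimator L x h),
   if b then grad f x else h).

(* The pair (x^k, h^k) along one realization of the sampled sets Ls and of the
   coins bs deciding whether h is refreshed. *)
Fixpoint svrcd (x0 : V) (Ls : nat -> {set 'I_n}) (bs : nat -> bool) (k : nat) :
    V * V :=
  if k is k'.+1 then svrcd_step (Ls k') (bs k') (svrcd x0 Ls bs k')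
  else (x0, 0).

End svrcd.

Definition svrcd_lyapunov {R : realType} {n : nat} (f : 'rV[R]_n -> R)
    (m : 'I_n -> R) (xstar : 'rV[R]_n) (alpha beta : R)
    (s : 'rV[R]_n * 'rV[R]_n) : R :=
  let: (x, h) := s in
  sqnorm (x - xstar) +
  alpha * beta ^+ 2 *
    \sum_(i < n) (m i)^-1 * (h 0 i - grad f xstar 0 i) ^+ 2.

Section sampling.
Context {d : measure_display} {T : measurableType d} {R : realType}.
Variable P : probability T R.

(* Random elements with values in a finite type, equipped with the discrete
   sigma-algebra: every set of values is an event. *)
Definition random_elt (A : finType) (X : T -> A) : Prop :=
  forall S : set A, measurable (X @^-1` S).

Definition same_law (A : finType) (X Y : T -> A) : Prop :=
  forall S : set A, P (X @^-1` S) = P (Y @^-1` S).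

Definition indep (A B : finType) (X : T -> A) (Y : T -> B) : Prop :=
  forall (S : set A) (U : set B),
    P (X @^-1` S `&` Y @^-1` U) = (P (X @^-1` S) * P (Y @^-1` U))%E.

Definition incl_prob (n : nat) (L : T -> {set 'I_n}) (i : 'I_n) : R :=
  fine (P [set w | i \in L w]).

Definition past (n : nat) (Ls : nat -> T -> {set 'I_n}) (bs : nat -> T -> bool)
    (k : nat) (w : T) : {ffun 'I_k -> {set 'I_n} * bool} :=
  [ffun j : 'I_k => (Ls j w, bs j w)].

(* At each step, Ls k is a copy of L independent of the past, and the coin
   bs k is Bernoulli(rho), independent of (Ls k, past) jointly. The starting
   point is deterministic, so the past consists of the previous draws. *)
Definition svrcd_sampling (n : nat) (L : T -> {set 'I_n}) (rho : R)
    (Ls : nat -> T -> {set 'I_n}) (bs : nat -> T -> bool) : Prop :=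
  forall k,
    [/\ random_elt (Ls k) /\ random_elt (bs k),
        same_law (Ls k) L,
        P [set w | bs k w = true] = rho%:E,
        indep (Ls k) (past Ls bs k) &
        indep (bs k) (fun w => (Ls k w, past Ls bs k w))].

End sampling.

(* Main.v *)
(* Nonexpansiveness of the proximal map and the fixed-point identity
   x* = prox (x* - alpha grad f x* ) reduce one step to the coordinatewise second
   moment of the estimator. With a = grad f x - grad f x* and b = h - grad f x*, the
   i-th moment is at most (2 / p_i) (a_i ^ 2 + b_i ^ 2). Convexity and smoothness bound
   sum_i a_i ^ 2 / m_i by twice the Bregman divergence of f between x and x*, which the
   quasi strong convexity inequality makes available in <a, x - x*>. With
   beta ^ 2 = 1 / (2 rho) everything combines into
   E[Psi^(k+1)] <= (1 - alpha sigma) E[Psi^k], and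
   1 / (alpha sigma) <= 1 / rho + max_i 4 m_i / (p_i sigma). Only finitely many draws
   determine the state at time k, so all expectations are finite sums. *)
Require Import Defs.
From HB Require Import structures.
From mathcomp Require Import all_boot all_order all_algebra.
From mathcomp Require Import all_classical all_reals all_analysis.
From mathcomp Require Import measurable_realfun ring lra.

Import Order.TTheory GRing.Theory Num.Theory.
Import numFieldNormedType.Exports.

Local Open Scope classical_set_scope.
Local Open Scope ring_scope.

(** * The Euclidean inner product and squared norm *)

Section euclidean_lemmas.
Context {R : realType} {n : nat}.
Implicit Types x y z : 'rV[R]_n.

Lemma dotvC x y : dotv x y = dotv y x.
Proof. by apply: eq_bigr => i _; rewrite mulrC. Qed.

Lemma dotvDl x y z : dotv (x + y) z = dotv x z + dotv y z.
Proof. by rewrite /dotv -big_split; apply: eq_bigr => i _; rewrite mxE mulrDl. Qed.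

Lemma dotvZl a x y : dotv (a *: x) y = a * dotv x y.
Proof. by rewrite /dotv mulr_sumr; apply: eq_bigr => i _; rewrite mxE mulrA. Qed.

Lemma dotvNl x y : dotv (- x) y = - dotv x y.
Proof. by rewrite -scaleN1r dotvZl mulN1r. Qed.

Lemma dotvDr x y z : dotv x (y + z) = dotv x y + dotv x z.
Proof. by rewrite dotvC dotvDl !(dotvC x). Qed.

Lemma dotvZr a x y : dotv x (a *: y) = a * dotv x y.
Proof. by rewrite dotvC dotvZl (dotvC x). Qed.

Lemma dotvNr x y : dotv x (- y) = - dotv x y.
Proof. by rewrite dotvC dotvNl (dotvC x). Qed.

Lemma sqnormE x : sqnorm x = \sum_(i < n) x 0 i ^+ 2.
Proof. by apply: eq_bigr => i _; rewrite expr2. Qed.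

Lemma sqnorm_ge0 x : 0 <= sqnorm x.
Proof. by rewrite sqnormE; apply: sumr_ge0 => i _; exact: sqr_ge0. Qed.

Lemma sqnormD x y : sqnorm (x + y) = sqnorm x + 2 * dotv x y + sqnorm y.
Proof. by rewrite /sqnorm !(dotvDl, dotvDr) (dotvC y x); ring. Qed.

Lemma sqnormZ a x : sqnorm (a *: x) = a ^+ 2 * sqnorm x.
Proof. by rewrite /sqnorm dotvZl dotvZr mulrA expr2. Qed.

Lemma sqr_coord_le_sqnorm x i : x 0 i ^+ 2 <= sqnorm x.
Proof.
by rewrite sqnormE (bigD1 i)//= lerDl; apply: sumr_ge0 => j _; exact: sqr_ge0.
Qed.

End euclidean_lemmas.

(** Divide by [t] and let [t] tend to 0; one explicit violating [t] stands in for the limit. *)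
Lemma slope_ge0 (R : realFieldType) (a C : R) :
  (forall t, 0 < t -> t <= 1 -> 0 <= t * a + t ^+ 2 * C) -> 0 <= a.
Proof.
move=> H; rewrite leNgt; apply/negP => a_lt0.
have C_le := ler_norm C; have C_ge0 := normr_ge0 C.
(* With [a < 0], [K] exceeds both [- a] and [C], so [t = - a / K] lies in (0, 1] and
   [t * a + t ^+ 2 * C = t * a * (K - C) / K] is negative. *)
set K := `|C| + 1 - a.
have K_gt0 : 0 < K by rewrite /K; lra.
have t_gt0 : 0 < - a / K by rewrite divr_gt0 // oppr_gt0.
have t_le1 : - a / K <= 1 by rewrite ler_pdivrMr // mul1r /K; lra.
have := H _ t_gt0 t_le1.
have -> : - a / K * a + (- a / K) ^+ 2 * C = (- a / K) * (a * ((K - C) / K)).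
  by field; rewrite gt_eqF.
rewrite pmulr_rge0 // nmulr_rge0 // pmulr_lle0 ?invr_gt0 // /K; lra.
Qed.

(** * First-order optimality conditions over the epigraph, where all inequalities are between
    reals *)

Section variational.
Context {R : realType} {n : nat}.
Local Notation V := 'rV[R]_n.
Implicit Types (psi : V -> \bar R) (u v x y z : V).

(* The perturbation [t *: (v - u)] costs [phi] only [t * dotv q (v - u)] to first
   order, while convexity makes [psi] change at most linearly in [t]. *)
Lemma epigraph_variational psi (alpha : R) (phi : V -> R) (q : V) (C : V -> R) u r :
  convex_efun psi -> 0 < alpha -> psi u = r%:E ->
  (forall v t, 0 <= t -> phi (u + t *: (v - u)) <=
                 phi u + t * dotv q (v - u) + t ^+ 2 * C v) ->
  (forall v s, epigraph psi (v, s) -> alpha * r + phi u <= alpha * s + phi v) ->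
  forall v s, epigraph psi (v, s) -> alpha * r <= alpha * s + dotv q (v - u).
Proof.
move=> psi_conv alpha_gt0 psi_u phi_le min_u v s vs.
suff : 0 <= alpha * (s - r) + dotv q (v - u) by lra.
apply: (@slope_ge0 _ _ (C v)) => t t_gt0 t_le1.
have t01 : 0 <= t <= 1 by rewrite ltW.
have e : u + t *: (v - u) = t *: v + (1 - t) *: u.
  by rewrite scalerBr scalerBl scale1r addrCA addrA -addrA.
have : epigraph psi (u + t *: (v - u), t * s + (1 - t) * r).
  rewrite /epigraph/= e; apply: (le_trans (psi_conv _ _ _ t01)).
  rewrite psi_u -EFinM [leRHS]EFinD leeD2r // EFinM.
  by apply: lee_wpmul2l => //; rewrite lee_fin ltW.
move=> /min_u; have := phi_le v t (ltW t_gt0); lra.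
Qed.

(** Here [phi] is half the squared distance to [z]: its gradient at [u] is [u - z], and its
    second-order expansion is exact. *)
Lemma prox_variational psi (alpha : R) z u r :
  convex_efun psi -> 0 < alpha -> psi u = r%:E ->
  (forall v s, epigraph psi (v, s) ->
     alpha * r + 2^-1 * sqnorm (u - z) <= alpha * s + 2^-1 * sqnorm (v - z)) ->
  forall v s, epigraph psi (v, s) -> alpha * r <= alpha * s + dotv (u - z) (v - u).
Proof.
move=> psi_conv alpha_gt0 psi_u.
apply: (@epigraph_variational _ _ (fun v => 2^-1 * sqnorm (v - z)) _
  (fun v => 2^-1 * sqnorm (v - u))) => // v t _.
rewrite /= [u + _ - z]addrAC (sqnormD (u - z)) sqnormZ dotvZr; lra.
Qed.

(** Testing each inequality at the other point and adding cancels the values of [psi] and leaves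
    [sqnorm (u1 - u2) <= dotv (z1 - z2) (u1 - u2)], firm nonexpansiveness. Expanding the square of
    [(z1 - z2) - (u1 - u2)] concludes. *)
Lemma variational_nonexpansive psi (alpha : R) z1 z2 u1 u2 r1 r2 :
  psi u1 = r1%:E -> psi u2 = r2%:E ->
  (forall v s, epigraph psi (v, s) ->
     alpha * r1 <= alpha * s + dotv (u1 - z1) (v - u1)) ->
  (forall v s, epigraph psi (v, s) ->
     alpha * r2 <= alpha * s + dotv (u2 - z2) (v - u2)) ->
  sqnorm (u1 - u2) <= sqnorm (z1 - z2).
Proof.
move=> psi1 psi2 /(_ u2 r2) H1 /(_ u1 r1) H2.
have {H1} := H1 _; rewrite /epigraph/= psi2 => /(_ (lexx _)) H1.
have {H2} := H2 _; rewrite /epigraph/= psi1 => /(_ (lexx _)) H2.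
have := sqnorm_ge0 ((z1 - z2) - (u1 - u2)); move: H1 H2.
rewrite /sqnorm !(dotvDl, dotvDr, dotvNl, dotvNr) !opprD !opprK.
rewrite !(dotvC u2 u1) !(dotvC z1 u1) !(dotvC z2 u1) !(dotvC z1 u2) !(dotvC z2 u2).
by rewrite !(dotvC z2 z1); lra.
Qed.

Lemma sqdist_continuous z : continuous (fun v => sqnorm (v - z)).
Proof.
under eq_fun do rewrite sqnormE.
apply: continuous_big => [|i _ v]; first exact: add_continuous.
apply: (@cvg_comp _ _ _ (fun w : V => (w - z) 0 i) (fun t : R => t ^+ 2)); last first.
  exact: exprn_continuous.
under eq_cvg do rewrite !mxE; rewrite !mxE.
exact: (cvgB (@coord_continuous R _ _ 0 i v) (cvg_cst _)).
Qed.

End variational.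

(** * Existence of the proximal point *)

Section prox.
Context {R : realType} {n : nat}.
Local Notation V := 'rV[R]_n.
Implicit Types (psi : V -> \bar R) (u v x y z : V).

(** The affine minorant makes the objective coercive. Minimizing [G] over pairs in the epigraph
    replaces a lower semicontinuous function by a continuous one on a closed set, so the extreme
    value theorem applies once a compact box contains a sublevel set. *)
Lemma prox_objective_min psi (alpha : R) (q a z : V) r :
  proper_efun psi -> closed_efun psi -> 0 < alpha -> psi a = r%:E ->
  (forall v s, epigraph psi (v, s) -> alpha * r <= alpha * s + dotv q (v - a)) ->
  exists u ru, psi u = ru%:E /\ forall v s, epigraph psi (v, s) ->
    alpha * ru + 2^-1 * sqnorm (u - z) <= alpha * s + 2^-1 * sqnorm (v - z).
Proof.
move=> [psi_gtNy _] psi_closed alpha_gt0 psi_a minorant.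
pose G (vs : V * R) := alpha * vs.2 + 2^-1 * sqnorm (vs.1 - z).
(* Adding [G vs <= G (a, r)] to the minorant and absorbing [dotv q (v - z)] by Young's inequality
   leaves a quarter of [sqnorm (v - z)] on the left, hence [B]. The minorant then gives [lo], and
   dropping the square from [G] gives [hi]. *)
pose B := 4 * (sqnorm q + dotv q (z - a) + 2^-1 * sqnorm (a - z)).
pose lo := r - (sqnorm q + 4^-1 * B + dotv q (z - a)) / alpha.
pose hi := (alpha * r + 2^-1 * sqnorm (a - z)) / alpha.
pose box := [set v : V | forall i, v ord0 i \in `[z 0 i - (B + 1), z 0 i + (B + 1)]]
  `*` `[lo, hi].
have in_box vs : epigraph psi vs -> G vs <= G (a, r) -> box vs.
  case: vs => v s vs; rewrite /G/= => G_le; have lb := minorant _ _ vs.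
  have young : dotv q (v - z) <= sqnorm q + 4^-1 * sqnorm (v - z).
    have := sqnorm_ge0 (q + (- 2^-1) *: (v - z)).
    rewrite sqnormD sqnormZ dotvZr; lra.
  have dotvE : dotv q (v - a) = dotv q (v - z) + dotv q (z - a).
    by rewrite -dotvDr addrA subrK.
  have B_ge : sqnorm (v - z) <= B by rewrite /B; lra.
  split=> /=.
    move=> i; have := le_trans (sqr_coord_le_sqnorm (v - z) i) B_ge.
    rewrite !mxE => sq_le.
    (* For [c = v 0 i - z 0 i], the squares of [c - 1/2] and [c + 1/2] bound both [c] and [- c] by
       [c ^+ 2 + 1/4], hence by [B + 1], without a square root. *)
    have := sqr_ge0 (v 0 i - z 0 i - 2^-1); have := sqr_ge0 (v 0 i - z 0 i + 2^-1).
    by rewrite in_itv/= sqrrB sqrrD => *; apply/andP; split; lra.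
  rewrite in_itv/= /hi ler_pdivlMr //; apply/andP; split; last first.
    by have := sqnorm_ge0 (v - z); lra.
  by rewrite /lo lerBlDr -lerBlDl ler_pdivlMr //; lra.
have epi_a : epigraph psi (a, r) by rewrite /epigraph/= psi_a.
have box_compact : compact (box `&` epigraph psi).
  apply: compact_closedI => //; apply: compact_setX; last exact: segment_compact.
  apply: (@rV_compact _ _ (fun i => `[z 0 i - (B + 1), z 0 i + (B + 1)]%classic)).
  by move=> i; exact: segment_compact.
have G_cont : continuous G.
  move=> vs; apply: cvgD.
    by apply: cvgM; [exact: cvg_cst|exact: cvg_snd].
  apply: cvgM; first exact: cvg_cst.
  apply: (@cvg_comp _ _ _ fst (fun v => sqnorm (v - z))); first exact: cvg_fst.
  exact: sqdist_continuous.
have [||[u s0]] := @compact_EVT_min _ _ G (box `&` epigraph psi) _ box_compact.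
- by exists (a, r); split => //; exact: in_box.
- exact: continuous_subspaceT.
rewrite inE => -[_ epi_u] G_min.
have := epi_u; rewrite /epigraph/=; case psi_u: (psi u) => [ru||] // ru_le; last first.
  by have := psi_gtNy u; rewrite psi_u.
exists u, ru; split=> // v s vs.
(* Minimality extends from the box to the whole epigraph: a point with [G] above [G (a, r)] cannot
   beat the minimum. *)
have {}G_min vs' : epigraph psi vs' -> G (u, s0) <= G vs'.
  move=> vs'_epi; have [le_a|lt_a] := leP (G vs') (G (a, r)).
    by apply: G_min; rewrite inE; split => //; exact: in_box.
  apply: le_trans _ (ltW lt_a); apply: G_min; rewrite inE; split => //.
  exact: in_box.
(* The minimizing pair may lie above the graph; lowering [s0] to [ru] only decreases [G]. *)
have := G_min (v, s) vs; rewrite /G/=; apply: le_trans.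
by rewrite lerD2r ler_pM2l.
Qed.

(** [get] returns a member of its set once the set is inhabited, so the existence of a minimizer
    carries over to [prox]. Comparison with that minimizer, together with properness, makes [psi]
    finite at the proximal point. *)
Lemma proxP psi (alpha : R) (q a z : V) r :
  proper_efun psi -> closed_efun psi -> 0 < alpha -> psi a = r%:E ->
  (forall v s, epigraph psi (v, s) -> alpha * r <= alpha * s + dotv q (v - a)) ->
  exists2 ru, psi (prox alpha psi z) = ru%:E &
    forall v s, epigraph psi (v, s) ->
      alpha * ru + 2^-1 * sqnorm (prox alpha psi z - z) <=
      alpha * s + 2^-1 * sqnorm (v - z).
Proof.
move=> psi_proper psi_closed alpha_gt0 psi_a minorant.
have [u [ru [psi_u u_min]]] := prox_objective_min psi alpha q a z r
  psi_proper psi_closed alpha_gt0 psi_a minorant.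
have psi_gtNy := psi_proper.1.
have prox_min v : (alpha%:E * psi (prox alpha psi z) +
    (2^-1 * sqnorm (prox alpha psi z - z))%:E <=
    alpha%:E * psi v + (2^-1 * sqnorm (v - z))%:E)%E.
  move: v; rewrite /prox; set A := argmin _.
  suff : A (get A) by [].
  apply: getPex; exists u => v.
  case psi_v: (psi v) => [s||]; last by have := psi_gtNy v; rewrite psi_v.
    rewrite psi_u -!EFinM -!EFinD lee_fin; apply: u_min.
    by rewrite /epigraph/= psi_v.
  by rewrite gt0_muley ?lte_fin // addye // leey.
have := prox_min u; rewrite psi_u.
case psi_p: (psi (prox alpha psi z)) => [rp||]; last 2 first.
- by rewrite gt0_muley ?lte_fin // addye // -EFinM -EFinD leNgt ltry.
- by have := psi_gtNy (prox alpha psi z); rewrite psi_p.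
move=> _; exists rp => // v s vs.
have := prox_min v; rewrite psi_p -EFinM -EFinD => le_v.
rewrite -lee_fin; apply: le_trans le_v _.
by rewrite [leRHS]EFinD leeD2r // EFinM lee_wpmul2l // lee_fin ltW.
Qed.

End prox.

(** * Consequences of convexity and diagonal smoothness of [f] *)

Section smooth_convex.
Context {R : realType} {n : nat}.
Local Notation V := 'rV[R]_n.
Variables (f : V -> R) (m : 'I_n -> R).
Hypotheses (f_conv : convex_fun f) (f_smooth : diag_smooth m f).
Hypothesis m_gt0 : forall i, 0 < m i.
Implicit Types x y : V.

Lemma convex_fun_le x y t : 0 <= t -> t <= 1 ->
  f (t *: x + (1 - t) *: y) <= t * f x + (1 - t) * f y.
Proof.
by move=> t0 t1; have := f_conv (Itv01 t0 t1) x y; rewrite !inE; exact.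
Qed.

(** This is the bound that [epigraph_variational] asks of [phi]. The sign of [t] is free, so that
    [convex_gradient_le] can step backwards. *)
Lemma diag_smooth_segment y x t :
  f (y + t *: (x - y)) <= f y + t * dotv (grad f y) (x - y) +
    t ^+ 2 * (2^-1 * \sum_(i < n) m i * (x 0 i - y 0 i) ^+ 2).
Proof.
have := f_smooth (y + t *: (x - y)) y; rewrite (addrAC y) subrr add0r dotvZr.
move=> /le_trans; apply; rewrite lerD2l mulrCA ler_pM2l // mulr_sumr.
apply: ler_sum => i _; rewrite !mxE le_eqVlt; apply/orP; left; apply/eqP; ring.
Qed.

(* Convexity at [y], a point between [x] and [y - t (x - y)], turns the upper bound
   on [f (y - t (x - y))] into a lower bound on [f x]; then let [t] tend to 0. *)
Lemma convex_gradient_le x y : f y + dotv (grad f y) (x - y) <= f x.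
Proof.
rewrite -subr_ge0; set C := 2^-1 * \sum_(i < n) m i * (x 0 i - y 0 i) ^+ 2.
apply: (@slope_ge0 _ _ C) => t t_gt0 _.
have := diag_smooth_segment y x (- t); rewrite -/C sqrrN; set z := y + _ => f_z.
have t1_gt0 : 0 < 1 + t by lra.
have th_ge0 : 0 <= t / (1 + t) by apply: divr_ge0; lra.
have th_le1 : t / (1 + t) <= 1 by rewrite ler_pdivrMr //; lra.
have := convex_fun_le x z _ th_ge0 th_le1.
have -> : t / (1 + t) *: x + (1 - t / (1 + t)) *: z = y.
  by apply/rowP => i; rewrite /z !mxE; field; lra.
have -> : t / (1 + t) * f x + (1 - t / (1 + t)) * f z = (t * f x + f z) / (1 + t).
  by field; lra.
by rewrite ler_pdivlMr //; lra.
Qed.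

(** The displacement [dl] minimizes the smoothness upper model at [x] of [f] minus the linear form
    [dotv (grad f y)]. Bounding [f (x + dl)] above by smoothness at [x] and below by convexity at
    [y] gives the claim. *)
Lemma cocoercive_bregman x y :
  \sum_(i < n) (m i)^-1 * (grad f x 0 i - grad f y 0 i) ^+ 2 <=
  2 * (f x - f y - dotv (grad f y) (x - y)).
Proof.
pose dl : V := \row_i (- (m i)^-1 * (grad f x 0 i - grad f y 0 i)).
have dlE i : dl 0 i = - (m i)^-1 * (grad f x 0 i - grad f y 0 i) by rewrite [LHS]mxE.
have := f_smooth (x + dl) x; have := convex_gradient_le (x + dl) y.
rewrite !(addrAC x dl) subrr add0r (dotvDr _ _ dl).
have -> : dotv (grad f x) dl = dotv (grad f y) dl -
    \sum_(i < n) (m i)^-1 * (grad f x 0 i - grad f y 0 i) ^+ 2.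
  rewrite /dotv -sumrB; apply: eq_bigr => i _; rewrite dlE; ring.
have -> : \sum_(i < n) m i * ((x + dl) 0 i - x 0 i) ^+ 2 =
    \sum_(i < n) (m i)^-1 * (grad f x 0 i - grad f y 0 i) ^+ 2.
  by apply: eq_bigr => i _; rewrite mxE dlE; field; rewrite gt_eqF.
lra.
Qed.

(** The conclusion says that [- grad f x] is a subgradient of [psi] at [x]. It is
    [epigraph_variational] with [alpha = 1] and [phi = f], the quadratic remainder coming from
    smoothness. *)
Lemma composite_minimizer_variational (psi : V -> \bar R) x :
  convex_efun psi -> proper_efun psi ->
  argmin (fun x => (f x)%:E + psi x)%E x ->
  exists2 r, psi x = r%:E & forall v s, epigraph psi (v, s) ->
    r <= s + dotv (grad f x) (v - x).
Proof.
move=> psi_conv [psi_gtNy [v0 v0_lty]] x_min.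
have x_lty : (psi x < +oo)%E.
  rewrite ltNge leye_eq; apply/negP => /eqP psi_x.
  have := x_min v0; rewrite psi_x addey // leye_eq => /eqP.
  by case: (psi v0) v0_lty.
case psi_x: (psi x) x_lty => [r||] // _; last by have := psi_gtNy x; rewrite psi_x.
exists r => // v s vs.
have := @epigraph_variational _ _ psi 1 f (grad f x)
  (fun v => 2^-1 * \sum_(i < n) m i * (v 0 i - x 0 i) ^+ 2) x r
  psi_conv ltr01 psi_x _ _ v s vs.
rewrite !mul1r; apply=> // [v' t _|v' s' vs']; first exact: diag_smooth_segment.
rewrite !mul1r -lee_fin addrC (addrC s') [leRHS]EFinD EFinD -psi_x.
by apply: le_trans (x_min v') _; exact: leeD2l.
Qed.

End smooth_convex.

(** * One step of the algorithm, averaged over its draws with the state fixed *)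

Section one_step.
Context {R : realType} {n : nat}.
Local Notation V := 'rV[R]_n.

Lemma svrcd_estimatorE (f : V -> R) p l x h i :
  svrcd_estimator f p l x h 0 i =
  h 0 i + (if i \in l then (p i)^-1 * (grad f x 0 i - h 0 i) else 0).
Proof.
rewrite /svrcd_estimator mxE summxE; congr (_ + _).
case: ifP => il; last first.
  rewrite big1 // => j jl; rewrite !mxE eqxx /=.
  by have [ij|_] := eqVneq i j; rewrite ?mulr0 //; rewrite -ij il in jl.
rewrite (bigD1 i) //= !mxE !eqxx /= mulr1 big1 ?addr0 // => j /andP[_ ji].
by rewrite !mxE eqxx /= eq_sym (negbTE ji) mulr0.
Qed.

(** Each coordinate sees the sampled set only through a Bernoulli variable, so arbitrary dependence
    between coordinates is harmless. *)
Lemma sum_incl (w : {set 'I_n} -> R) (i : 'I_n) (phi : bool -> R) :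
  \sum_l w l = 1 ->
  \sum_l w l * phi (i \in l) =
  (\sum_(l : {set 'I_n} | i \in l) w l) * phi true +
  (1 - \sum_(l : {set 'I_n} | i \in l) w l) * phi false.
Proof.
move=> w1; rewrite (bigID (fun l : {set 'I_n} => i \in l)) /=; congr (_ + _).
  by rewrite mulr_suml; apply: eq_bigr => l ->.
have -> : 1 - \sum_(l : {set 'I_n} | i \in l) w l = \sum_(l : {set 'I_n} | i \notin l) w l.
  by rewrite -w1 (bigID (fun l : {set 'I_n} => i \in l)) /= addrAC subrr add0r.
by rewrite mulr_suml; apply: eq_bigr => l /negbTE ->.
Qed.

(* This choice of [beta] makes the refresh of [h] use up half of the term
   [alpha * a ^+ 2 / m]; the other half, and the decrease of the [b] term, pay for
   the variance of the estimator. *)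
Lemma coordinate_contraction (alpha beta sigma rho m p u a b : R) :
  0 < alpha -> 0 < sigma -> 0 < rho -> rho <= 1 -> 0 < m -> 0 < p -> p <= 1 ->
  alpha * (4 * m / p + sigma / rho) <= 1 -> beta ^+ 2 = (2 * rho)^-1 ->
  p * (u - alpha * (b + p^-1 * (a - b))) ^+ 2 + (1 - p) * (u - alpha * b) ^+ 2 +
  alpha * beta ^+ 2 * (m^-1 * (rho * a ^+ 2 + (1 - rho) * b ^+ 2)) <=
  u ^+ 2 - 2 * alpha * (a * u) + alpha * (m^-1 * a ^+ 2) +
  (1 - alpha * sigma) * (alpha * beta ^+ 2 * (m^-1 * b ^+ 2)).
Proof.
move=> alpha_gt0 sigma_gt0 rho_gt0 rho_le1 m_gt0 p_gt0 p_le1 alpha_le betaE.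
rewrite betaE.
pose q := p^-1; have q_ge1 : 1 <= q by rewrite /q invf_ge1.
(* Bias-variance decomposition: the estimator has mean [a] and variance [(q - 1) * (a - b) ^+ 2]. *)
have -> : p * (u - alpha * (b + p^-1 * (a - b))) ^+ 2 + (1 - p) * (u - alpha * b) ^+ 2 =
   u ^+ 2 - 2 * alpha * (a * u) + alpha ^+ 2 * (a ^+ 2 + (q - 1) * (a - b) ^+ 2).
  by rewrite /q; field; rewrite gt_eqF.
have var_le : a ^+ 2 + (q - 1) * (a - b) ^+ 2 <= 2 * q * (a ^+ 2 + b ^+ 2).
  have -> : 2 * q * (a ^+ 2 + b ^+ 2) = a ^+ 2 + (q - 1) * (a - b) ^+ 2 +
     (a ^+ 2 + 2 * b ^+ 2 + (q - 1) * (a + b) ^+ 2) by ring.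
  rewrite lerDl; apply: addr_ge0; first by rewrite addr_ge0 ?sqr_ge0 // mulr_ge0 ?sqr_ge0.
  by rewrite mulr_ge0 ?sqr_ge0 // subr_ge0.
have b_le : 4 * alpha * q <= m^-1 * (1 - alpha * sigma / rho).
  rewrite [leRHS]mulrC ler_pdivlMr //; move: alpha_le; rewrite /q; lra.
have a_le : 4 * alpha * q <= m^-1.
  apply: le_trans b_le _; apply: ler_piMr; first by rewrite invr_ge0 ltW.
  by rewrite gerBl ltW // divr_gt0 ?mulr_gt0.
have -> : alpha * (2 * rho)^-1 * (m^-1 * (rho * a ^+ 2 + (1 - rho) * b ^+ 2)) =
    alpha / 2 * m^-1 * a ^+ 2 + alpha / 2 * (m^-1 * ((1 - rho) / rho)) * b ^+ 2.
  by field; rewrite !gt_eqF.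
have -> : (1 - alpha * sigma) * (alpha * (2 * rho)^-1 * (m^-1 * b ^+ 2)) =
    alpha / 2 * (m^-1 * ((1 - rho) / rho)) * b ^+ 2 +
    alpha / 2 * (m^-1 * (1 - alpha * sigma / rho)) * b ^+ 2.
  by field; rewrite !gt_eqF.
have var_bound : alpha ^+ 2 * (a ^+ 2 + (q - 1) * (a - b) ^+ 2) <=
    alpha / 2 * m^-1 * a ^+ 2 +
    alpha / 2 * (m^-1 * (1 - alpha * sigma / rho)) * b ^+ 2.
  apply: (@le_trans _ _ (alpha / 2 * (4 * alpha * q) * a ^+ 2 +
                          alpha / 2 * (4 * alpha * q) * b ^+ 2)).
    have -> : alpha / 2 * (4 * alpha * q) * a ^+ 2 + alpha / 2 * (4 * alpha * q) * b ^+ 2 =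
       alpha ^+ 2 * (2 * q * (a ^+ 2 + b ^+ 2)) by field.
    by rewrite ler_wpM2l // sqr_ge0.
  by rewrite lerD // ler_wpM2r ?sqr_ge0 // ler_wpM2l // divr_ge0 // ltW.
lra.
Qed.

Variables (f : V -> R) (psi : V -> \bar R) (m p : 'I_n -> R) (xstar : V).
Variables (sigma rho alpha beta : R) (w : {set 'I_n} -> R).
Hypotheses (f_conv : convex_fun f) (f_smooth : diag_smooth m f).
Hypothesis m_gt0 : forall i, 0 < m i.
Hypotheses (psi_proper : proper_efun psi) (psi_closed : closed_efun psi).
Hypothesis psi_conv : convex_efun psi.
Hypothesis xstar_min : argmin (fun x => (f x)%:E + psi x)%E xstar.
Hypotheses (sigma_gt0 : 0 < sigma) (f_qsc : quasi_strongly_convex sigma f xstar).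
Hypotheses (rho_gt0 : 0 < rho) (rho_le1 : rho <= 1) (alpha_gt0 : 0 < alpha).
Hypothesis alpha_le : forall i, alpha * (4 * m i / p i + sigma / rho) <= 1.
Hypothesis betaE : beta ^+ 2 = (2 * rho)^-1.
Hypotheses (w_ge0 : forall l, 0 <= w l) (w_sum : \sum_l w l = 1).
Hypothesis w_incl : forall i, \sum_(l : {set 'I_n} | i \in l) w l = p i.
Hypothesis p_gt0 : forall i, 0 < p i.

(** Optimality of [xstar], scaled by [alpha], is exactly the variational inequality of the proximal
    map at [xstar - alpha *: grad f xstar]. The same inequality is the affine minorant required by
    [proxP]. *)
Lemma prox_step_nonexpansive z :
  sqnorm (prox alpha psi z - xstar) <=
  sqnorm (z - (xstar - alpha *: grad f xstar)).
Proof.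
have [r psi_x x_var] := composite_minimizer_variational _ _ f_smooth _ _
  psi_conv psi_proper xstar_min.
have x_var' v s : epigraph psi (v, s) ->
    alpha * r <= alpha * s + dotv (alpha *: grad f xstar) (v - xstar).
  by move=> /x_var; rewrite dotvZl -mulrDr ler_pM2l.
have [ru psi_u u_min] := proxP psi alpha _ _ z r psi_proper psi_closed alpha_gt0
  psi_x x_var'.
apply: (variational_nonexpansive psi alpha _ _ _ _ ru r psi_u psi_x).
  exact: prox_variational.
by rewrite opprB addrC subrK.
Qed.

Lemma svrcd_contraction s :
  let Psi := svrcd_lyapunov f m xstar alpha beta in
  \sum_l w l * (rho * Psi (svrcd_step f psi p alpha l true s) +
                (1 - rho) * Psi (svrcd_step f psi p alpha l false s)) <=
  (1 - alpha * sigma) * Psi s.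
Proof.
case: s => x h /=.
set g := grad f xstar.
pose u i := x 0 i - xstar 0 i; pose a i := grad f x 0 i - g 0 i.
pose b i := h 0 i - g 0 i.
(* The squared [i]-th coordinate of the difference of the two prox arguments, [c] telling whether
   [i] was sampled. *)
pose N c i := (u i - alpha * (b i + (if c then (p i)^-1 * (a i - b i) else 0))) ^+ 2.
have subE (e e' : V) i : (x - alpha *: e - (xstar - alpha *: e')) 0 i =
    u i - alpha * (e 0 i - e' 0 i) by rewrite !mxE /u; ring.
have step_le l : sqnorm (prox alpha psi (x - alpha *: svrcd_estimator f p l x h) - xstar)
    <= \sum_(i < n) N (i \in l) i.
  apply: (le_trans (prox_step_nonexpansive _)); rewrite sqnormE.
  apply: ler_sum => i _; rewrite le_eqVlt; apply/orP; left; apply/eqP.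
  by rewrite subE svrcd_estimatorE /N /a /b -/g; case: ifP => _; ring.
(* The coin changes only the [h] part of the Lyapunov function; [E] is the average of that part. *)
pose E := alpha * beta ^+ 2 *
  \sum_(i < n) (m i)^-1 * (rho * a i ^+ 2 + (1 - rho) * b i ^+ 2).
have E_split A : rho * (A + alpha * beta ^+ 2 * \sum_(i < n) (m i)^-1 * a i ^+ 2) +
  (1 - rho) * (A + alpha * beta ^+ 2 * \sum_(i < n) (m i)^-1 * b i ^+ 2) = A + E.
  have -> : E = alpha * beta ^+ 2 * (rho * (\sum_(i < n) (m i)^-1 * a i ^+ 2) +
      (1 - rho) * \sum_(i < n) (m i)^-1 * b i ^+ 2).
    rewrite /E; congr (_ * _); rewrite !mulr_sumr -big_split.
    by apply: eq_bigr => i _ /=; ring.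
  ring.
under eq_bigr do rewrite E_split.
have {E_split} : \sum_l w l *
     (sqnorm (prox alpha psi (x - alpha *: svrcd_estimator f p l x h) - xstar) + E)
  <= \sum_(i < n) (p i * N true i + (1 - p i) * N false i) + E.
  under eq_bigr do rewrite mulrDr.
  rewrite big_split /= -mulr_suml w_sum mul1r lerD2r.
  under [leRHS]eq_bigr => i _ do rewrite -w_incl -(sum_incl w i (N ^~ i) w_sum).
  rewrite exchange_big; apply: ler_sum => l _.
  by rewrite -mulr_sumr ler_wpM2l.
move=> /le_trans; apply.
have p_le1 i : p i <= 1.
  by rewrite -w_incl -w_sum [leRHS](bigID (fun l : {set 'I_n} => i \in l)) /= lerDl sumr_ge0.
have coords : \sum_(i < n) (p i * N true i + (1 - p i) * N false i) + E <=
    \sum_(i < n) (u i ^+ 2 - 2 * alpha * (a i * u i) + alpha * ((m i)^-1 * a i ^+ 2) +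
    (1 - alpha * sigma) * (alpha * beta ^+ 2 * ((m i)^-1 * b i ^+ 2))).
  rewrite /E mulr_sumr -big_split /=; apply: ler_sum => i _.
  rewrite /N addr0; exact: coordinate_contraction.
apply: (le_trans coords).
rewrite !big_split /= sumrN -!mulr_sumr.
have uE i : (x - xstar) 0 i = u i by rewrite !mxE.
have -> : \sum_(i < n) u i ^+ 2 = sqnorm (x - xstar).
  by rewrite sqnormE; apply: eq_bigr => i _; rewrite uE.
have -> : \sum_(i < n) a i * u i = dotv (grad f x) (x - xstar) - dotv g (x - xstar).
  by rewrite /dotv -sumrB; apply: eq_bigr => i _; rewrite uE /a; ring.
(* Quasi strong convexity bounds [dotv (grad f x - g) (x - xstar)] below by the Bregman divergence
   plus [sigma / 2 * sqnorm (x - xstar)]. After multiplication by [2 * alpha], the divergence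
   absorbs the sum of [a i ^+ 2 / m i], and the rest is the factor [1 - alpha * sigma]. *)
have := f_qsc x; rewrite -(opprB x) dotvNr -(ler_pM2l alpha_gt0) => f_qsc_x.
have := cocoercive_bregman f m f_conv f_smooth m_gt0 x xstar.
rewrite -/g -(ler_pM2l alpha_gt0) => cocoercive_x.
by move: f_qsc_x cocoercive_x; rewrite /a /b; lra.
Qed.

End one_step.

(** * Mass functions and expectations of finite-valued random elements *)

Section finite_random_elements.
Context {d : measure_display} {T : measurableType d} {R : realType}.
Variable P : probability T R.

Definition pmass (A : finType) (X : T -> A) (a : A) : R := fine (P (X @^-1` [set a])).

Lemma pmassK (A : finType) (X : T -> A) a : random_elt X ->
  P (X @^-1` [set a]) = (pmass A X a)%:E.
Proof. by move=> mX; rewrite /pmass fineK // fin_num_measure. Qed.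

Lemma pmass_ge0 (A : finType) (X : T -> A) a : 0 <= pmass A X a.
Proof. exact: fine_ge0. Qed.

Lemma random_elt_fibers (A : finType) (X : T -> A) :
  (forall a, measurable (X @^-1` [set a])) -> random_elt X.
Proof.
move=> mX S.
have -> : X @^-1` S = \bigcup_(a in S) X @^-1` [set a].
  by apply/seteqP; split=> [w Sw|w [a Sa /= ->]] //; exists (X w).
exact: fin_bigcup_measurable.
Qed.

Lemma random_elt_pair (A B : finType) (X : T -> A) (Y : T -> B) :
  random_elt X -> random_elt Y -> random_elt (fun w => (X w, Y w)).
Proof.
move=> mX mY; apply: random_elt_fibers => -[a b].
have -> : (fun w => (X w, Y w)) @^-1` [set (a, b)] =
    X @^-1` [set a] `&` Y @^-1` [set b].
  by apply/seteqP; split=> [w [/= -> ->]|w [/= -> ->]].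
exact: measurableI.
Qed.

Lemma random_elt_ffun (I A : finType) (X : I -> T -> A) :
  (forall i, random_elt (X i)) -> random_elt (fun w => [ffun i => X i w]).
Proof.
move=> mX; apply: random_elt_fibers => g.
have -> : (fun w => [ffun i => X i w]) @^-1` [set g] =
    \bigcap_(i in [set: I]) X i @^-1` [set g i].
  apply/seteqP; split=> [w /= <- i _ /=|w Xw /=]; first by rewrite ffunE.
  by apply/ffunP => i; rewrite ffunE; exact: Xw.
by apply: fin_bigcap_measurable => // i _; exact: mX.
Qed.

(** The integrand is a finite combination of indicators of the fibers of [X]; nonnegativity of [phi]
    lets the integral be taken termwise. *)
Lemma expectation_finite (A : finType) (X : T -> A) (phi : A -> R) :
  random_elt X -> (forall a, 0 <= phi a) ->
  ('E_P[fun w => phi (X w)] = (\sum_a phi a * pmass A X a)%R%:E)%E.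
Proof.
move=> mX phi_ge0; rewrite unlock.
have phiE w : (phi (X w))%:E =
    (\sum_a (phi a)%:E * (\1_(X @^-1` [set a]) w)%:E)%E.
  rewrite (bigD1 (X w)) //= big1 ?adde0 => [|a aX].
    by rewrite indicE mem_set //= mule1.
  by rewrite indicE memNset ?mule0 //= => /esym/eqP; exact/negP.
under eq_integral do rewrite phiE.
rewrite ge0_integral_sum //=; last 2 first.
- move=> a; apply/measurable_EFinP; apply: measurable_funM => //.
- by move=> a w _; rewrite mule_ge0 // lee_fin.
rewrite -sumEFin; apply: eq_bigr => a _.
rewrite ge0_integralZl_EFin //; last first.
  by apply/measurable_EFinP; apply: measurable_indic; exact: mX.
by rewrite integral_indic // setIT EFinM -pmassK.
Qed.

Lemma sum_pmass (A : finType) (X : T -> A) (S : pred A) : random_elt X ->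
  \sum_(a | S a) pmass A X a = fine (P (X @^-1` [set a | S a])).
Proof.
move=> mX; apply: EFin_inj; rewrite fineK ?fin_num_measure //.
rewrite -expectation_indic //.
have -> : \1_(X @^-1` [set a | S a]) = (fun w => (S (X w))%:R) :> (T -> R).
  by apply/funext => w; rewrite indicE; congr ((nat_of_bool _)%:R); apply/idP/idP; rewrite inE.
rewrite (expectation_finite _ X (fun a => (S a)%:R)) //; congr (_%:E).
by rewrite big_mkcond; apply: eq_bigr => a _; case: ifP => _; rewrite (mul1r, mul0r).
Qed.

Lemma sum_pmass1 (A : finType) (X : T -> A) : random_elt X ->
  \sum_a pmass A X a = 1.
Proof.
move=> mX; rewrite sum_pmass //.
have -> : X @^-1` [set a | true] = setT by apply/seteqP; split.
by rewrite probability_setT.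
Qed.

Lemma pmass_pair_indep (A B : finType) (X : T -> A) (Y : T -> B) a b :
  random_elt X -> random_elt Y -> indep P X Y ->
  pmass _ (fun w => (X w, Y w)) (a, b) = pmass _ X a * pmass _ Y b.
Proof.
move=> mX mY XY; rewrite /pmass -fineM; last 2 first.
- by apply: fin_num_measure; exact: mX.
- by apply: fin_num_measure; exact: mY.
rewrite -XY; congr (fine (P _)).
by apply/seteqP; split=> [w [/= -> ->]|w [/= -> ->]].
Qed.

End finite_random_elements.

Lemma sum_prod (R : nmodType) (A B : finType) (F : A * B -> R) :
  \sum_ab F ab = \sum_a \sum_b F (a, b).
Proof. by rewrite pair_bigA; apply: eq_bigr => -[]. Qed.

(** * The state as a function of finitely many draws *)

Section trajectory.
Context {R : realType} {n : nat}.
Local Notation V := 'rV[R]_n.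
Variables (f : V -> R) (psi : V -> \bar R) (p : 'I_n -> R) (alpha : R) (x0 : V).

Lemma svrcd_eq_draws k (Ls Ls' : nat -> {set 'I_n}) (bs bs' : nat -> bool) :
  (forall j, (j < k)%N -> Ls j = Ls' j /\ bs j = bs' j) ->
  svrcd f psi p alpha x0 Ls bs k = svrcd f psi p alpha x0 Ls' bs' k.
Proof.
elim: k => //= k IHk eq_draws; have [-> ->] := eq_draws k (ltnSn k).
by rewrite IHk // => j jk; apply: eq_draws; exact: ltnW.
Qed.

(* The draws outside the range of [q] are junk: [svrcd] never reads them. *)
Definition draw k (q : {ffun 'I_k -> {set 'I_n} * bool}) (j : nat) :=
  if insub j is Some i then q i else (finset.set0, false).

(** Factoring the state through the finite type of past draws is what makes [expectation_finite]
    applicable. *)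
Definition svrcd_past k (q : {ffun 'I_k -> {set 'I_n} * bool}) : V * V :=
  svrcd f psi p alpha x0 (fun j => (draw k q j).1) (fun j => (draw k q j).2) k.

Lemma svrcd_pastE (d : measure_display) (T : measurableType d)
    (Ls : nat -> T -> {set 'I_n}) (bs : nat -> T -> bool) k w :
  svrcd f psi p alpha x0 (Ls ^~ w) (bs ^~ w) k = svrcd_past k (past Ls bs k w).
Proof.
apply: svrcd_eq_draws => j jk; rewrite /draw insubT /= ffunE //.
Qed.

End trajectory.

(** * Contraction in expectation and the iteration count *)

Section expected_contraction.
Context {R : realType} {n : nat}.
Local Notation V := 'rV[R]_n.
Variables (f : V -> R) (psi : V -> \bar R) (m : 'I_n -> R) (xstar : V).
Variables (sigma rho alpha beta : R).
Context {d : measure_display} {T : measurableType d}.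
Variables (P : probability T R) (L : T -> {set 'I_n}).
Variables (Ls : nat -> T -> {set 'I_n}) (bs : nat -> T -> bool) (x0 : V).
Hypotheses (f_conv : convex_fun f) (f_smooth : diag_smooth m f).
Hypothesis m_gt0 : forall i, 0 < m i.
Hypotheses (psi_proper : proper_efun psi) (psi_closed : closed_efun psi).
Hypothesis psi_conv : convex_efun psi.
Hypothesis xstar_min : argmin (fun x => (f x)%:E + psi x)%E xstar.
Hypotheses (sigma_gt0 : 0 < sigma) (f_qsc : quasi_strongly_convex sigma f xstar).
Hypotheses (rho_gt0 : 0 < rho) (rho_le1 : rho <= 1) (alpha_gt0 : 0 < alpha).
Hypothesis alpha_le :
  forall i, alpha * (4 * m i / incl_prob P L i + sigma / rho) <= 1.
Hypothesis betaE : beta ^+ 2 = (2 * rho)^-1.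
Hypothesis p_gt0 : forall i, 0 < incl_prob P L i.
Hypothesis sampling : svrcd_sampling P L rho Ls bs.

Let Psi := svrcd_lyapunov f m xstar alpha beta.
Let state k w := svrcd f psi (incl_prob P L) alpha x0 (Ls ^~ w) (bs ^~ w) k.

Lemma svrcd_lyapunov_ge0 s : 0 <= Psi s.
Proof.
case: s => x h /=; rewrite addr_ge0 ?sqnorm_ge0 // mulr_ge0 //.
  by rewrite mulr_ge0 ?sqr_ge0 // ltW.
by apply: sumr_ge0 => i _; rewrite mulr_ge0 ?sqr_ge0 // invr_ge0 ltW.
Qed.

Lemma random_elt_past k : random_elt (past Ls bs k).
Proof.
apply: random_elt_ffun => i; have [[mL mb] _ _ _ _] := sampling i.
exact: random_elt_pair.
Qed.

(** The next state is a function of the coin, the set and the past, whose joint mass factors by the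
    two independence assumptions. For each fixed past, the inner sum is the one bounded by
    [svrcd_contraction]. *)
Lemma expectation_lyapunov_step k :
  ('E_P[fun w => Psi (state k.+1 w)] <=
   (1 - alpha * sigma)%R%:E * 'E_P[fun w => Psi (state k w)])%E.
Proof.
have [[mL mb] same_L b_true indep_L indep_b] := sampling k.
pose S := svrcd_past f psi (incl_prob P L) alpha x0 k.
pose step l b q := svrcd_step f psi (incl_prob P L) alpha l b (S q).
pose phi (blq : bool * ({set 'I_n} * {ffun 'I_k -> {set 'I_n} * bool})) :=
  Psi (step blq.2.1 blq.1 blq.2.2).
have mLq := random_elt_pair _ _ _ _ mL (random_elt_past k).
have mX := random_elt_pair _ _ _ _ mb mLq.
have -> : (fun w => Psi (state k w)) = (fun w => Psi (S (past Ls bs k w))).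
  by apply/funext => w; rewrite /state svrcd_pastE.
have -> : (fun w => Psi (state k.+1 w)) =
   (fun w => phi (bs k w, (Ls k w, past Ls bs k w))).
  by apply/funext => w; rewrite /state /= svrcd_pastE.
rewrite (expectation_finite P _ _ phi mX) => [|[b [l q]]]; last exact: svrcd_lyapunov_ge0.
rewrite (expectation_finite P _ _ (fun q => Psi (S q)) (random_elt_past k)) => [|q];
  last exact: svrcd_lyapunov_ge0.
rewrite -EFinM lee_fin.
pose w l := pmass P _ (Ls k) l.
have b_trueE : pmass P _ (bs k) true = rho.
  by rewrite /pmass (_ : _ @^-1` _ = [set w | bs k w = true]) // b_true.
have b_falseE : pmass P _ (bs k) false = 1 - rho.
  by rewrite -(sum_pmass1 P _ _ mb) big_bool b_trueE /= addrAC subrr add0r.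
have w_incl i : \sum_(l : {set 'I_n} | i \in l) w l = incl_prob P L i.
  rewrite /w sum_pmass // /incl_prob; congr fine.
  exact: (same_L [set l : {set 'I_n} | i \in l]).
have -> : \sum_a phi a *
     pmass P _ (fun w => (bs k w, (Ls k w, past Ls bs k w))) a =
   \sum_q (\sum_l w l * (rho * Psi (step l true q) + (1 - rho) * Psi (step l false q))) *
     pmass P _ (past Ls bs k) q.
  rewrite sum_prod big_bool -big_split sum_prod.
  rewrite exchange_big; apply: eq_bigr => q _; rewrite mulr_suml.
  apply: eq_bigr => l _.
  rewrite !(pmass_pair_indep P _ _ _ _ _ _ mb mLq indep_b).
  rewrite (pmass_pair_indep P _ _ _ _ _ _ mL (random_elt_past k) indep_L).
  by rewrite b_trueE b_falseE -/(w l) /phi /=; ring.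
rewrite mulr_sumr; apply: ler_sum => q _; rewrite mulrA ler_wpM2r ?pmass_ge0 //.
apply: svrcd_contraction => // [l|]; first exact: pmass_ge0.
exact: sum_pmass1.
Qed.

Lemma expectation_lyapunov_le k : 0 <= 1 - alpha * sigma ->
  ('E_P[fun w => Psi (state k w)] <=
   ((1 - alpha * sigma) ^+ k * Psi (x0, 0))%R%:E)%E.
Proof.
move=> rate_ge0; elim: k => [|k IHk]; first by rewrite expr0 mul1r expectation_cst.
apply: (le_trans (expectation_lyapunov_step k)).
by rewrite exprS -mulrA EFinM lee_wpmul2l // lee_fin.
Qed.

End expected_contraction.

(** From [1 - r <= expR (- r)], the power is at most [expR (- (r * k))], and
    [r * k >= r * N * ln eps^-1 >= ln eps^-1]. *)
Lemma contraction_complexity (R : realType) (r N eps : R) (k : nat) :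
  0 <= r <= 1 -> 1 <= r * N -> 0 < eps < 1 -> N * ln (eps^-1) <= k%:R ->
  (1 - r) ^+ k <= eps.
Proof.
move=> /andP[r_ge0 r_le1] rN_ge1 /andP[eps_gt0 eps_lt1] k_ge.
have ln_ge0 : 0 <= ln eps^-1 by rewrite ln_ge0 // ltW // invf_gt1.
apply: (@le_trans _ _ (expR (- r) ^+ k)).
  by apply: lerXn2r; rewrite ?nnegrE ?subr_ge0 ?expR_ge0 // expR_ge1Dx.
rewrite -expRM_natl -[leRHS](invrK eps) -[in leRHS](@lnK _ eps^-1) ?posrE ?invr_gt0 //.
rewrite -expRN ler_expR mulrN lerN2.
have := ler_wpM2l r_ge0 k_ge; rewrite (mulrC k%:R); apply: le_trans.
by rewrite mulrA ler_peMl.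
Qed.

Theorem corollaryH3 (R : realType) (n : nat)
  (f : 'rV[R]_n.+1 -> R) (psi : 'rV[R]_n.+1 -> \bar R)
  (xstar : 'rV[R]_n.+1) (sigma : R) (m : 'I_n.+1 -> R)
  (f_diff : forall x, differentiable f x)
  (f_conv : convex_fun f)
  (psi_proper : proper_efun psi)
  (psi_closed : closed_efun psi)
  (psi_conv : convex_efun psi)
  (xstar_min : argmin (fun x => (f x)%:E + psi x)%E = [set xstar])
  (sigma_gt0 : 0 < sigma)
  (f_qsc : quasi_strongly_convex sigma f xstar)
  (m_gt0 : forall i, 0 < m i)
  (f_smooth : diag_smooth m f)
  (d : measure_display) (T : measurableType d) (P : probability T R)
  (L : T -> {set 'I_n.+1}) (L_rv : random_elt L)
  (p_gt0 : forall i, 0 < incl_prob P L i)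
  (rho : R) (rho01 : 0 < rho <= 1)
  (x0 : 'rV[R]_n.+1)
  (Ls : nat -> T -> {set 'I_n.+1}) (bs : nat -> T -> bool)
  (sampling : svrcd_sampling P L rho Ls bs)
  (alpha : R)
  (alphaE : alpha =
     min_fam (fun i => (4 * m i / incl_prob P L i + sigma / rho)^-1)) :
  exists2 beta : R, 0 < beta &
    let state k w :=
      svrcd f psi (incl_prob P L) alpha x0 (Ls ^~ w) (bs ^~ w) k in
    let Psi := svrcd_lyapunov f m xstar alpha beta in
    forall (eps : R) (k : nat), 0 < eps < 1 ->
      (rho^-1 + max_fam (fun i => 4 * m i / (incl_prob P L i * sigma)))
        * ln (eps^-1) <= k%:R ->
      ('E_P[fun w => Psi (state k w)] <= (eps * Psi (x0, 0%R))%:E)%E.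
Proof.
have [rho_gt0 rho_le1] := andP rho01.
have alpha_le i : alpha * (4 * m i / incl_prob P L i + sigma / rho) <= 1.
  have D_gt0 : 0 < 4 * m i / incl_prob P L i + sigma / rho.
    by rewrite addr_gt0 // divr_gt0 // mulr_gt0.
  by rewrite -ler_pdivlMr // mul1r alphaE /min_fam; exact: bigmin_le.
set N := rho^-1 + max_fam (fun i => 4 * m i / (incl_prob P L i * sigma)).
have N_ge i : 4 * m i / incl_prob P L i + sigma / rho <= N * sigma.
  have -> : 4 * m i / incl_prob P L i + sigma / rho =
      (rho^-1 + 4 * m i / (incl_prob P L i * sigma)) * sigma.
    by field; rewrite !gt_eqF.
  by rewrite ler_pM2r // lerD2l /max_fam; exact: le_bigmax.
have D_gt0 i : 0 < 4 * m i / incl_prob P L i + sigma / rho.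
  by rewrite addr_gt0 // divr_gt0 // mulr_gt0.
have Nsigma_gt0 : 0 < N * sigma := lt_le_trans (D_gt0 ord0) (N_ge ord0).
(* Every denominator in the minimum is at most [N * sigma], which yields [1 <= alpha * sigma * N],
   the rate needed at the end. *)
have alpha_ge : (N * sigma)^-1 <= alpha.
  rewrite alphaE /min_fam; apply/bigmin_geP.
  by split=> [|i _]; rewrite lef_pV2 ?posrE.
have alpha_gt0 : 0 < alpha by apply: lt_le_trans alpha_ge; rewrite invr_gt0.
(* The stepsize gives [alpha * sigma <= rho], and [rho <= 1]. *)
have rate_le1 : alpha * sigma <= 1.
  have := alpha_le ord0; rewrite mulrDr => h.
  have ap_gt0 : 0 < alpha * (4 * m ord0 / incl_prob P L ord0).
    by rewrite mulr_gt0 // divr_gt0 // mulr_gt0.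
  have : alpha * (sigma / rho) <= 1 by lra.
  by rewrite mulrA ler_pdivrMr // mul1r => /le_trans; apply.
exists (Num.sqrt (2 * rho)^-1); first by rewrite sqrtr_gt0 invr_gt0 mulr_gt0.
have betaE : Num.sqrt (2 * rho)^-1 ^+ 2 = (2 * rho)^-1.
  by rewrite sqr_sqrtr // invr_ge0 mulr_ge0 // ltW.
have x_min : argmin (fun x => (f x)%:E + psi x)%E xstar by rewrite xstar_min.
move=> state Psi eps k eps01 k_ge.
have := expectation_lyapunov_le f psi m xstar sigma rho alpha _ P L Ls bs x0
  f_conv f_smooth m_gt0 psi_proper psi_closed psi_conv x_min sigma_gt0 f_qsc
  rho_gt0 rho_le1 alpha_gt0 alpha_le betaE p_gt0 sampling k.
rewrite subr_ge0 => /(_ rate_le1) /le_trans; apply; rewrite lee_fin.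
apply: ler_wpM2r; first exact: svrcd_lyapunov_ge0.
apply: contraction_complexity eps01 k_ge; first by rewrite rate_le1 andbT mulr_ge0 // ltW.
by rewrite -mulrA (mulrC sigma) -ler_pdivrMr // div1r.
Qed.
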